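(* Let $n \ge 1$ and $M = 2^m$ with $m \ge 1$ an integer (so $m = \log_2 M$). Let $\{(x^{(t)}, r^{(t)}) \in \mathbb{R}^n \times \{1,-1\} : t = 1, \ldots, M\}$ be training samples, let $\sigma = \max_{r,s}\|x^{(r)} - x^{(s)}\| / \sqrt{2M}$, and let $f : \mathbb{R}^n \to \mathbb{R}^M$ be the feature map $$f(x) = \left(e^{-\|x - x^{(1)}\|^2/(2\sigma^2)}, \ldots, e^{-\|x - x^{(M)}\|^2/(2\sigma^2)}\right).$$ For $\vec{\theta} = (\theta_1, \ldots, \theta_m) \in \mathbb{R}^m$ define the weight vector $$w(\vec{\theta}) = \bigotimes_{j=1}^m \begin{pmatrix} \cos\theta_j \\ \sin\theta_j \end{pmatrix} \in \mathbb{R}^M,$$ and the loss $$L(\vec{\theta}) = \frac{1}{2M} \sum_{t=1}^M \Big(f(x^{(t)}) \cdot w(\vec{\theta}) - r^{(t)}\Big)^2.$$ When minimizing $L(\vec{\theta})$ over $\vec\theta\in\mathbb{R}^m$: if the gradient descent method is used, each iteration step can be carried out at (classical arithmetic) cost $O(nM^2)$; if Newton's method is used, each iteration step can be carried out at cost $O\big(M^2(n + \log^2 M)\big)$.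
   Context: Costs are counted as the number of classical arithmetic operations. Equivalently to the tensor-product definition, writing $t = t_1 + t_2 2 + \cdots + t_m 2^{m-1}$ in binary for $t \in \{0, 1, \ldots, M-1\}$, the $t$-th entry of $w(\vec{\theta})$ is $\prod_{j=1}^m \cos(\theta_j - t_j\pi/2)$. A gradient descent step computes $\nabla L(\vec\theta)$ and updates $\vec\theta$; a Newton step computes $\nabla L(\vec\theta)$, the $m\times m$ Hessian $\nabla^2 L(\vec\theta)$, and solves with (inverts) the Hessian. Potential degeneracies (zero gradient, singular Hessian) are not considered. *)

(* Defs.v *)
From HB Require Import structures.
From mathcomp Require Import all_boot all_order all_algebra.
From mathcomp Require Import all_classical all_reals all_analysis.
Set Implicit Arguments. Unset Strict Implicit. Unset Printing Implicit Defensive.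
Import Order.TTheory GRing.Theory Num.Theory.
Local Open Scope ring_scope.

(* Cost model: straight-line arithmetic programs over the reals.       *)
(* Registers start with the input values; every instruction appends    *)
(* one new register value computed from earlier registers (referred to *)
(* by index).  Each instruction costs one classical arithmetic         *)
(* operation.  Constants are rational.                                  *)
Inductive instr : Type :=
| ICst  of rat
| IAdd  of nat & nat
| ISub  of nat & nat
| IMul  of nat & nat
| IDiv  of nat & nat
| IExp  of nat
| ISin  of nat
| ICos  of nat
| ISqrt of nat
| IMax  of nat & nat
| IIfLt of nat & nat & nat & nat.

Record slp : Type := SLP { slp_body : seq instr ; slp_out : seq nat }.

Definition eval_instr {R : realType} (regs : seq R) (i : instr) : R :=
  let g k := nth 0 regs k in
  match i with
  | ICst q => ratr q
  | IAdd a b => g a + g b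
  | ISub a b => g a - g b
  | IMul a b => g a * g b
  | IDiv a b => g a / g b
  | IExp a => expR (g a)
  | ISin a => sin (g a)
  | ICos a => cos (g a)
  | ISqrt a => Num.sqrt (g a)
  | IMax a b => Num.max (g a) (g b)
  | IIfLt a b c d => if g a < g b then g c else g d
  end.

Definition slp_run {R : realType} (inp : seq R) (body : seq instr) : seq R :=
  foldl (fun regs i => rcons regs (eval_instr regs i)) inp body.

Definition slp_eval {R : realType} (P : slp) (inp : seq R) : seq R :=
  let regs := slp_run inp (slp_body P) in [seq nth 0 regs k | k <- slp_out P].

Definition slp_cost (P : slp) : nat := size (slp_body P).

(* Indices t are 0-based: t : 'I_(2^m).                                 *)
Section Problem.
Variables (R : realType) (n m : nat).
Local Notation M := (2 ^ m)%N.
Variables (xs : 'I_M -> 'I_n -> R) (r : 'I_M -> R).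

Definition eucl_norm (v : 'I_n -> R) : R := Num.sqrt (\sum_i v i ^+ 2).

Definition sigma : R :=
  (\big[Num.max/0]_(a < M) \big[Num.max/0]_(b < M)
      eucl_norm (fun i => xs a i - xs b i)) / Num.sqrt (2 * M%:R).

Definition feature (x : 'I_n -> R) (s : 'I_M) : R :=
  expR (- (eucl_norm (fun i => x i - xs s i)) ^+ 2 / (2 * sigma ^+ 2)).

(* j-th binary digit of t (j = 0 least significant), i.e. t_{j+1} *)
Definition bit (t : nat) (j : nat) : nat := odd (t %/ 2 ^ j).

Definition weight (theta : 'I_m -> R) (t : 'I_M) : R :=
  \prod_(j < m) cos (theta j - (bit t j)%:R * pi / 2).

Definition loss (theta : 'I_m -> R) : R :=
  (2 * M%:R)^-1 * \sum_(t < M)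
     ((\sum_(s < M) feature (xs t) s * weight theta s) - r t) ^+ 2.

Definition upd (theta : 'I_m -> R) (j : 'I_m) (y : R) : 'I_m -> R :=
  fun k => if k == j then y else theta k.

Definition partial (F : ('I_m -> R) -> R) (j : 'I_m) (theta : 'I_m -> R) : R :=
  derive1 (fun y => F (upd theta j y)) (theta j).

Definition grad (theta : 'I_m -> R) : 'cV[R]_m :=
  \col_i partial loss i theta.

Definition hessian (theta : 'I_m -> R) : 'M[R]_m :=
  \matrix_(i, j) partial (partial loss i) j theta.

Definition gd_step (eta : R) (theta : 'I_m -> R) : 'I_m -> R :=
  fun j => theta j - eta * grad theta j ord0.

Definition newton_step (theta : 'I_m -> R) : 'I_m -> R :=
  fun j => theta j - (invmx (hessian theta) *m grad theta) j ord0.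

Definition encode (theta : 'I_m -> R) (extra : seq R) : seq R :=
  flatten [seq [seq xs t i | i <- enum 'I_n] | t <- enum 'I_M]
  ++ [seq r t | t <- enum 'I_M] ++ [seq theta j | j <- enum 'I_m] ++ extra.

End Problem.

Definition vec_out {R : realType} (m : nat) (v : 'I_m -> R) : seq R :=
  [seq v j | j <- enum 'I_m].

(* Main.v *)
Require Import Defs.
From HB Require Import structures.
From mathcomp Require Import all_boot all_order all_algebra.
From mathcomp Require Import all_classical all_reals all_analysis.
From mathcomp Require Import zify.
Set Implicit Arguments. Unset Strict Implicit. Unset Printing Implicit Defensive.
Import Order.TTheory GRing.Theory Num.Theory.
Local Open Scope ring_scope.

(* Write [F] for the matrix of the features [feature (xs t) s] and [e] for the
   vector of residuals.  The gradient is [M^-1 * sum_t e_t (F d_i w)_t]; the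
   point is to sum over [t] first, i.e. to form [g = F^T e] once, in O(M^2)
   operations, and to take the [m] scalar products of [g] with the vectors
   [d_i w] afterwards: this avoids a factor [m] in front of [M^2].  The Hessian
   [M^-1 * ((F d_i w) . (F d_j w) + g . d_i d_j w)] needs in addition the [m]
   products [F d_i w], in O(m M^2) operations.
   The Newton system is solved by Huang's method, which needs no pivoting and
   is thus directly a straight-line program: it processes the equations one by one,
   keeping a solution of those already seen together with the orthogonal
   projection onto the complement of the span of their rows.
   Costs are bounded by a calculus on functions of the input: a program is a
   way to enlarge the set of functions that are held in some register. *)

(** * A cost calculus for straight-line programs *)

Section Computes.
Local Open Scope classical_set_scope.
Variables (R : realType) (E : Type).
Implicit Types (A B C : set (E -> R)) (f g : E -> R) (regs : seq (E -> R)).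
Implicit Types (body : seq instr) (c : nat).

(** Symbolic execution: registers hold functions of the input [e], so that one program is followed
    on all inputs at once. *)
Definition fun_run regs body : seq (E -> R) :=
  foldl (fun regs i => rcons regs (fun e => eval_instr [seq q e | q <- regs] i))
    regs body.

Lemma slp_run_map regs body e :
  slp_run [seq q e | q <- regs] body = [seq q e | q <- fun_run regs body].
Proof.
rewrite /slp_run; elim: body regs => //= i body IH regs.
by rewrite -IH map_rcons.
Qed.

Lemma fun_run_cat regs body body' :
  fun_run regs (body ++ body') = fun_run (fun_run regs body) body'.
Proof. exact: foldl_cat. Qed.

Lemma mem_fun_run regs body f : f \in regs -> f \in fun_run regs body.
Proof.
elim: body regs => //= i body IH regs fr.
by apply: IH; rewrite mem_rcons inE fr orbT.
Qed.

(* From registers holding the functions in [A], [c] more instructions give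
   registers holding those in [B]. *)
Definition computes A c B :=
  forall regs, (forall f, A f -> f \in regs) ->
  exists2 body, (size body <= c)%N & forall f, B f -> f \in fun_run regs body.

Lemma computes_leq A c c' B : computes A c B -> (c <= c')%N -> computes A c' B.
Proof.
move=> AB cc' regs /AB[body sb Bb]; exists body => //.
exact: leq_trans sb cc'.
Qed.

Lemma computes_eq A c f g :
  f =1 g -> computes A c [set f] -> computes A c [set g].
Proof. by move=> /funext ->. Qed.

Lemma computes_subset A B : B `<=` A -> computes A 0 B.
Proof. by move=> BA regs Ar; exists [::] => // f /BA/Ar. Qed.

Lemma computes_mem A f : A f -> computes A 0 [set f].
Proof. by move=> Af; apply: computes_subset => _ ->. Qed.

(** Registers are never overwritten, so [A] is still available once [B] is computed. This is how
    intermediate results are shared: they are paid for once. *)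
Lemma computes_cut A c1 B c2 C :
  computes A c1 B -> computes (A `|` B) c2 C -> computes A (c1 + c2) C.
Proof.
move=> AB ABC regs Ar; have [b1 s1 B1] := AB _ Ar.
have [|b2 s2 C2] := ABC (fun_run regs b1).
  by move=> f [/Ar /mem_fun_run|/B1].
exists (b1 ++ b2); first by rewrite size_cat leq_add.
by move=> f Cf; rewrite fun_run_cat C2.
Qed.

Lemma computesU A c1 B c2 C :
  computes A c1 B -> computes A c2 C -> computes A (c1 + c2) (B `|` C).
Proof.
move=> AB AC regs Ar; have [b1 s1 B1] := AB _ Ar.
have [|b2 s2 C2] := AC (fun_run regs b1).
  by move=> f /Ar /mem_fun_run.
exists (b1 ++ b2); first by rewrite size_cat leq_add.
by move=> f; rewrite fun_run_cat => -[/B1 /mem_fun_run|/C2].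
Qed.

Lemma computes_bigcup_seq (I : eqType) (s : seq I) A c (B : I -> set (E -> R)) :
  (forall i, computes A c (B i)) ->
  computes A (size s * c) (\bigcup_(i in [set` s]) B i).
Proof.
move=> AB; elim: s => [|i s IH].
  by apply: computes_subset => f [].
rewrite /= mulSn.
move=> regs Ar; have [b sb Bb] := computesU (AB i) IH Ar.
exists b => // f [j /=]; rewrite inE => /orP[/eqP-> Bf|js Bf].
  by apply: Bb; left.
by apply: Bb; right; exists j.
Qed.

Lemma computes_range (I : finType) A c (F : I -> E -> R) :
  (forall i, computes A c [set F i]) -> computes A (#|I| * c) (range F).
Proof.
move=> AF; rewrite cardE => regs Ar.
have [b sb Bb] := computes_bigcup_seq (enum I) AF Ar.
by exists b => // f [i _ <-]; apply: Bb; exists i => //=; rewrite mem_enum.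
Qed.

Lemma computes_range_ord (N : nat) A c (F : 'I_N -> E -> R) :
  (forall i, computes A c [set F i]) -> computes A (N * c) (range F).
Proof. by move=> /computes_range; rewrite card_ord. Qed.

Lemma computes_range2_ord (N K : nat) A c (F : 'I_N -> 'I_K -> E -> R) :
  (forall i j, computes A c [set F i j]) ->
  computes A (N * K * c) [set f | exists i j, f = F i j].
Proof.
move=> AF regs Ar.
have [b] := computes_range (F := fun p : 'I_N * 'I_K => F p.1 p.2)
  (fun p => AF p.1 p.2) Ar.
rewrite card_prod !card_ord => sb Bb.
by exists b => // f [i [j ->]]; apply: Bb; exists (i, j).
Qed.

Lemma computes_cst A q : computes A 1 [set fun=> ratr q].
Proof.
by move=> regs Ar; exists [:: ICst q] => // _ -> /=; rewrite mem_rcons mem_head.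
Qed.

Lemma computes_nat A k : computes A 1 [set fun=> k%:R].
Proof.
by apply: computes_eq (@computes_cst A k%:R) => e; rewrite ratr_nat.
Qed.

Lemma computes_inv_nat A k : computes A 1 [set fun=> k%:R^-1].
Proof.
by apply: computes_eq (@computes_cst A k%:R^-1) => e; rewrite fmorphV /= ratr_nat.
Qed.

Lemma nth_index_map regs f e : f \in regs ->
  nth 0 [seq q e | q <- regs] (index f regs) = f e.
Proof. by move=> fr; rewrite (nth_map f) ?index_mem// nth_index. Qed.

Lemma computes_unop (mk : nat -> instr) (op : R -> R) A c f :
  (forall (rs : seq R) a, eval_instr rs (mk a) = op (nth 0 rs a)) ->
  computes A c [set f] -> computes A c.+1 [set fun e => op (f e)].
Proof.
move=> mkE Af regs Ar; have [b sb /(_ f erefl) fb] := Af _ Ar.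
exists (rcons b (mk (index f (fun_run regs b)))); first by rewrite size_rcons.
move=> _ ->; rewrite -cats1 fun_run_cat /= mem_rcons inE; apply/orP; left.
by apply/eqP/funext => e; rewrite mkE nth_index_map.
Qed.

(** The costs of the operands add up: an expression is charged as a tree, and sharing has to come
    from [computes_cut]. *)
Lemma computes_binop (mk : nat -> nat -> instr) (op : R -> R -> R) A c1 c2 f g :
  (forall (rs : seq R) a b, eval_instr rs (mk a b) = op (nth 0 rs a) (nth 0 rs b)) ->
  computes A c1 [set f] -> computes A c2 [set g] ->
  computes A (c1 + c2).+1 [set fun e => op (f e) (g e)].
Proof.
move=> mkE Af Ag regs Ar.
have [b sb fgb] := computesU Af Ag Ar.
have fb : f \in fun_run regs b by apply: fgb; left.
have gb : g \in fun_run regs b by apply: fgb; right.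
exists (rcons b (mk (index f (fun_run regs b)) (index g (fun_run regs b)))).
  by rewrite size_rcons.
move=> _ ->; rewrite -cats1 fun_run_cat /= mem_rcons inE; apply/orP; left.
by apply/eqP/funext => e; rewrite mkE !nth_index_map.
Qed.

Lemma computes_add A c1 c2 f g :
  computes A c1 [set f] -> computes A c2 [set g] ->
  computes A (c1 + c2).+1 [set fun e => f e + g e].
Proof. exact: (@computes_binop IAdd). Qed.

Lemma computes_sub A c1 c2 f g :
  computes A c1 [set f] -> computes A c2 [set g] ->
  computes A (c1 + c2).+1 [set fun e => f e - g e].
Proof. exact: (@computes_binop ISub (fun x y => x - y)). Qed.

Lemma computes_mul A c1 c2 f g :
  computes A c1 [set f] -> computes A c2 [set g] ->
  computes A (c1 + c2).+1 [set fun e => f e * g e].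
Proof. exact: (@computes_binop IMul). Qed.

Lemma computes_div A c1 c2 f g :
  computes A c1 [set f] -> computes A c2 [set g] ->
  computes A (c1 + c2).+1 [set fun e => f e / g e].
Proof. exact: (@computes_binop IDiv (fun x y => x / y)). Qed.

Lemma computes_opp A c f :
  computes A c [set f] -> computes A c.+2 [set fun e => - f e].
Proof.
move=> Af; apply: computes_eq (computes_sub (@computes_nat A 0) Af) => e.
exact: sub0r.
Qed.

(** A single instruction reads the same register twice, so the operand is charged once, where
    [computes_mul] would charge it twice. *)
Lemma computes_sqr A c f :
  computes A c [set f] -> computes A c.+1 [set fun e => f e ^+ 2].
Proof.
move=> Af regs Ar; have [b sb /(_ f erefl) fb] := Af _ Ar.
set k := index f (fun_run regs b).
exists (rcons b (IMul k k)); first by rewrite size_rcons.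
move=> _ ->; rewrite -cats1 fun_run_cat /= mem_rcons inE; apply/orP; left.
by apply/eqP/funext => e; rewrite !nth_index_map// expr2.
Qed.

Lemma computes_expR A c f :
  computes A c [set f] -> computes A c.+1 [set fun e => expR (f e)].
Proof. exact: (@computes_unop IExp). Qed.

Lemma computes_cos A c f :
  computes A c [set f] -> computes A c.+1 [set fun e => cos (f e)].
Proof. exact: (@computes_unop ICos). Qed.

Lemma computes_sin A c f :
  computes A c [set f] -> computes A c.+1 [set fun e => sin (f e)].
Proof. exact: (@computes_unop ISin). Qed.

Lemma computes_sqrt A c f :
  computes A c [set f] -> computes A c.+1 [set fun e => Num.sqrt (f e)].
Proof. exact: (@computes_unop ISqrt). Qed.

Lemma computes_big (mk : nat -> nat -> instr) (op : R -> R -> R) (k : nat)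
    (N : nat) A c (F : 'I_N -> E -> R) :
  (forall (rs : seq R) a b, eval_instr rs (mk a b) = op (nth 0 rs a) (nth 0 rs b)) ->
  (forall i, computes A c [set F i]) ->
  computes A (N * c.+1).+1 [set fun e => \big[op/k%:R]_(i < N) F i e].
Proof.
move=> mkE AF.
(* The factor [N] becomes the length of the enumeration of ['I_N], which allows an induction on that
   list. *)
rewrite -[N in (N * _)%N]card_ord cardT enumT.
apply: (@computes_eq _ _ (fun e => \big[op/k%:R]_(i <- Finite.enum 'I_N) F i e)).
  by move=> e; rewrite /index_enum; case: index_enum_key.
elim: (Finite.enum 'I_N) => [|i s IH].
  by apply: computes_eq (@computes_nat A k) => e; rewrite big_nil.
apply: (@computes_eq _ _ (fun e => op (F i e) (\big[op/k%:R]_(j <- s) F j e))).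
  by move=> e; rewrite big_cons.
apply: (computes_leq (computes_binop mkE (AF i) IH)).
by rewrite /= mulSn addnS addSn.
Qed.

Lemma computes_sum (N : nat) A c (F : 'I_N -> E -> R) :
  (forall i, computes A c [set F i]) ->
  computes A (N * c.+1).+1 [set fun e => \sum_(i < N) F i e].
Proof. exact: (@computes_big IAdd _ 0). Qed.

Lemma computes_prod (N : nat) A c (F : 'I_N -> E -> R) :
  (forall i, computes A c [set F i]) ->
  computes A (N * c.+1).+1 [set fun e => \prod_(i < N) F i e].
Proof. exact: (@computes_big IMul _ 1). Qed.

Lemma computes_max (N : nat) A c (F : 'I_N -> E -> R) :
  (forall i, computes A c [set F i]) ->
  computes A (N * c.+1).+1 [set fun e => \big[Num.max/0]_(i < N) F i e].
Proof. exact: (@computes_big IMax _ 0). Qed.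

(** Return to [slp_eval]: the output positions are found by searching the symbolic registers, hence
    are the same for every [e]. *)
Lemma computes_slp (N : nat) A c (F : 'I_N -> E -> R) regs (inp : E -> seq R) :
  (forall e, [seq q e | q <- regs] = inp e) -> (forall f, A f -> f \in regs) ->
  computes A c (range F) ->
  exists2 P, (slp_cost P <= c)%N &
    forall e, slp_eval P (inp e) = vec_out (fun j => F j e).
Proof.
move=> regsE Ar AF; have [b sb Fb] := AF _ Ar.
exists (SLP b [seq index (F j) (fun_run regs b) | j <- enum 'I_N]) => // e.
rewrite /slp_eval /= -regsE slp_run_map -map_comp.
by apply: eq_map => j /=; rewrite nth_index_map//; apply: Fb; exists j.
Qed.

End Computes.

(** * Huang's method for a nonsingular linear system *)

Section Huang.
Variables (R : realFieldType) (m : nat) (H : 'M[R]_m) (g : 'cV[R]_m).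
Implicit Types (st : 'cV[R]_m * 'M[R]_m) (s : seq 'I_m).

(** Here [v] is the projection by [P] of row [k], and [d] is its squared norm when [P] is an
    orthogonal projection. The solution moves along [v] until equation [k] holds, and the direction
    [v] is removed from [P]. *)
Definition huang_step st (k : 'I_m) : 'cV[R]_m * 'M[R]_m :=
  let: (x, P) := st in
  let v := \col_i \sum_j P i j * H k j in
  let d := \sum_j H k j * v j 0 in
  let e := (g k 0 - \sum_j H k j * x j 0) / d in
  (\col_i (x i 0 + v i 0 * e), \matrix_(i, j) (P i j - v i 0 * v j 0 / d)).

Definition huang s := foldl huang_step (0, 1%:M) s.

(* The rows of [1%:M - st.2] are combinations, with coefficients [C], of the
   rows of [H] with index in [s]. *)
Definition huang_inv s st :=
  [/\ st.2^T = st.2, st.2 *m st.2 = st.2,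
      forall i, i \in s -> row i H *m st.2 = 0,
      forall i, i \in s -> (row i H *m st.1) 0 0 = g i 0 &
      exists C : 'M[R]_m, 1%:M - st.2 = C *m H /\
        forall i, i \notin s -> col i C = 0].

Hypothesis H_unit : H \in unitmx.

(** The vector [v] is orthogonal to the rows already seen, so a move along it keeps their equations.
    Nonsingularity of [H] makes row [k] independent of them, whence [d != 0]. *)
Lemma huang_step_inv s st k : k \notin s -> huang_inv s st ->
  huang_inv (rcons s k) (huang_step st k).
Proof.
case: st => x P ks [/= PT PP rowP rowx [C [CE C0]]].
set h := row k H.
set v := P *m h^T.
set d := \sum_j H k j * v j 0.
have dE : h *m v = d%:M.
  apply/matrixP => i j; rewrite !ord1 !mxE eqxx mulr1n.
  by apply: eq_bigr => l _; rewrite !mxE.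
have vT : v^T = h *m P by rewrite /v trmx_mul trmxK PT.
have CH : (delta_mx 0 k - h *m C) *m H = h *m P.
  by rewrite mulmxBl -rowE -mulmxA -CE mulmxBr mulmx1 subKr.
(* Otherwise [CH] and the invertibility of [H] give [delta_mx 0 k = h *m C], but column [k] of [C]
   is zero because [k] is not in [s]. *)
have hP : h *m P != 0.
  apply/eqP => hP0.
  have := congr1 (fun A => A *m invmx H) CH.
  rewrite hP0 mul0mx mulmxK// => /eqP; rewrite subr_eq0 => /eqP /matrixP /(_ 0 k).
  rewrite !mxE !eqxx big1 => [/eqP|j _]; first by rewrite oner_eq0.
  by have /matrixP /(_ j 0) := C0 k ks; rewrite !mxE => ->; rewrite mulr0.
have Pv : P *m v = v by rewrite /v mulmxA PP.
have vv : v^T *m v = d%:M by rewrite vT -mulmxA Pv.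
(* By [vv], [d] is a sum of squares; if it vanished, so would [v], against [hP]. *)
have d0 : d != 0.
  apply: contra hP => /eqP d0.
  have : \sum_i v i 0 ^+ 2 = 0.
    transitivity ((v^T *m v) 0 0); last by rewrite vv d0 !mxE mul0rn.
    by rewrite !mxE; apply: eq_bigr => i _; rewrite !mxE expr2.
  move/eqP; rewrite psumr_eq0 => [/allP v0|i _]; last exact: sqr_ge0.
  suff v_eq0 : v = 0 by rewrite -vT v_eq0 trmx0.
  apply/colP => j; rewrite [RHS]mxE; apply/eqP; rewrite -sqrf_eq0.
  by have := v0 j (mem_index_enum j); rewrite implyTb.
pose e := (g k 0 - (h *m x) 0 0) / d.
have stepE : huang_step (x, P) k = (x + e *: v, P - d^-1 *: (v *m v^T)).
  have vE : \col_i (\sum_j P i j * H k j) = v.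
    apply/matrixP => i j; rewrite !mxE.
    by apply: eq_bigr => l _; rewrite !mxE.
  rewrite /huang_step vE -/d; congr (_, _).
    apply/matrixP => i j; rewrite !mxE ord1 mulrC; congr (_ + _ / _ * _).
    by rewrite mxE; congr (_ - _); apply: eq_bigr => l _; rewrite !mxE.
  by apply/matrixP => i j; rewrite !mxE big_ord1 !mxE mulrC.
have hv i : i \in s -> row i H *m v = 0.
  by move=> si; rewrite /v mulmxA rowP// mul0mx.
have vP : v^T *m P = v^T by rewrite vT -mulmxA PP.
rewrite -[X in huang_inv _ X]/(huang_step (x, P) k) stepE; split => /=.
- by rewrite linearB linearZ/= trmx_mul trmxK PT.
- have PQ : P *m (v *m v^T) = v *m v^T by rewrite mulmxA Pv.
  have QP : v *m v^T *m P = v *m v^T by rewrite -mulmxA vP.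
  have QQ : v *m v^T *m (v *m v^T) = d *: (v *m v^T).
    by rewrite -mulmxA (mulmxA v^T) vv mul_scalar_mx -scalemxAr.
  rewrite mulmxBl !mulmxBr PP -!scalemxAl -!scalemxAr PQ QP QQ.
  by rewrite (scalerA d^-1 d) mulVf// scale1r subrr subr0.
- move=> i; rewrite mem_rcons inE => /orP[/eqP->|si].
    rewrite mulmxBr -scalemxAr mulmxA dE mul_scalar_mx scalerA mulVf//.
    by rewrite scale1r vT subrr.
  by rewrite mulmxBr rowP// -scalemxAr mulmxA hv// mul0mx scaler0 subr0.
- move=> i; rewrite mem_rcons inE => /orP[/eqP->|si].
    rewrite mulmxDr -scalemxAr dE mxE [X in _ + X]mxE [d%:M _ _]mxE eqxx mulr1n.
    by rewrite divfK// addrC subrK.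
  by rewrite mulmxDr -scalemxAr hv// scaler0 addr0 rowx.
(* The update adds [d^-1 *: (v *m v^T)] to [1%:M - P], and [CH] writes [v^T] as
   [delta_mx 0 k - h *m C] times [H]. *)
- exists (C + d^-1 *: (v *m (delta_mx 0 k - h *m C))); split.
    by rewrite mulmxDl -scalemxAl -mulmxA CH vT -CE opprB addrA addrAC.
  clearbody v h; move=> i; rewrite mem_rcons inE negb_or => /andP[ik si].
  apply/matrixP => a b; rewrite !mxE big_ord1 !mxE.
  have Ci j : C j i = 0 by have /matrixP /(_ j 0) := C0 i si; rewrite !mxE.
  rewrite Ci big1 => [|j _]; last by rewrite Ci mulr0.
  by rewrite (negbTE ik) andbF subr0 !mulr0 addr0.
Qed.

(** Once all rows are processed, the fourth clause of [huang_inv] is the full system. *)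
Lemma huangP : (huang (enum 'I_m)).1 = invmx H *m g.
Proof.
have inv s : uniq s -> huang_inv s (huang s).
  elim/last_ind: s => [_|s k IH].
    split => //=; [exact: trmx1|exact: mulmx1|].
    by exists 0; rewrite subrr mul0mx; split => // i _; apply/matrixP => a b; rewrite !mxE.
  rewrite rcons_uniq => /andP[ks /IH IHs].
  by rewrite /huang -cats1 foldl_cat cats1; apply: huang_step_inv.
have [_ _ _ rowx _] := inv _ (enum_uniq 'I_m).
rewrite -[LHS](mulKmx H_unit); congr (_ *m _).
apply/matrixP => i j; rewrite ord1 -(rowx i) ?mem_enum//.
by rewrite !mxE; apply: eq_bigr => l _; rewrite !mxE.
Qed.

End Huang.

(** * Closed forms of the gradient and of the Hessian *)

Section Derivatives.
Variables (R : realType) (n m : nat).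
Local Notation M := (2 ^ m)%N.
Variables (xs : 'I_M -> 'I_n -> R) (r : 'I_M -> R).
Implicit Types (theta : 'I_m -> R) (i j : 'I_m) (k : 'I_m -> nat).

(* The [p]-th derivative of [fun y => cos (y - b * pi / 2)]. *)
Definition phase (p b : nat) (y : R) : R :=
  cos (y - b%:R * pi / 2 + p%:R * (pi / 2)).

Lemma phaseSS (p : nat) b y : phase p.+2 b y = - phase p b y.
Proof.
rewrite /phase -cosDpi; congr cos; rewrite -(addn2 p) natrD mulrDl addrA.
by congr (_ + _); rewrite mulrC divfK ?pnatr_eq0.
Qed.

Lemma phase00 y : phase 0 0 y = cos y.
Proof. by rewrite /phase !mul0r subr0 addr0. Qed.

Lemma phase01 y : phase 0 1 y = sin y.
Proof. by rewrite /phase mul0r addr0 mul1r cosBpihalf. Qed.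

Lemma phase10 y : phase 1 0 y = - sin y.
Proof. by rewrite /phase !mul0r subr0 mul1r cosDpihalf. Qed.

Lemma phase11 y : phase 1 1 y = cos y.
Proof. by rewrite /phase !mul1r subrK. Qed.

(** Since [- sin] is [cos] advanced by a quarter turn, differentiation only raises [p]. *)
Lemma is_derive_phase (p : nat) b (y : R) :
  is_derive y 1 (phase p b) (phase p.+1 b y).
Proof.
pose c : R := - (b%:R * pi / 2) + p%:R * (pi / 2).
rewrite (_ : phase p b = cos \o shift c); last first.
  by apply/funext => z; rewrite /phase /= addrA.
apply: (@is_derive_eq _ _ _ _ _ _ _ (- sin (shift c y) * (1 + 0))).
rewrite addr0 mulr1 -cosDpihalf /phase /= /c; congr cos.
by rewrite -[in RHS](addn1 p) natrD (mulrDl p%:R 1) mul1r !addrA.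
Qed.

(** Unlike [partial], this carries differentiability along, as the product rule requires. *)
Definition is_partial (F : ('I_m -> R) -> R) i theta d :=
  is_derive (theta i) 1 (fun y => F (upd theta i y)) d.

Lemma upd_id theta i : upd theta i (theta i) = theta.
Proof. by apply/funext => j; rewrite /upd; case: eqP => [->|]. Qed.

Lemma is_partial_val F i theta d : is_partial F i theta d ->
  partial F i theta = d.
Proof. by move=> Fd; rewrite /partial derive1E; case: Fd. Qed.

Lemma is_partial_mul F G i theta d d' :
  is_partial F i theta d -> is_partial G i theta d' ->
  is_partial (fun th => F th * G th) i theta (F theta * d' + G theta * d).
Proof.
move=> Fd Gd; have := is_deriveM Fd Gd; rewrite upd_id.
exact.
Qed.

Lemma is_partial_sum N (F : 'I_N -> ('I_m -> R) -> R) i theta d :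
  (forall l, is_partial (F l) i theta (d l)) ->
  is_partial (fun th => \sum_(l < N) F l th) i theta (\sum_(l < N) d l).
Proof.
move=> Fd; have := is_derive_sum Fd.
by rewrite (_ : \sum_(l < N) _ = (fun y => \sum_(l < N) F l (upd theta i y))) //;
  apply/funext => y; rewrite fct_sumE.
Qed.

Lemma is_partial_cst c i theta : is_partial (fun=> c) i theta 0.
Proof. exact: is_derive_cst. Qed.

Lemma is_partial_add F G i theta d d' :
  is_partial F i theta d -> is_partial G i theta d' ->
  is_partial (fun th => F th + G th) i theta (d + d').
Proof. exact: is_deriveD. Qed.

Lemma is_partial_scale c F i theta d : is_partial F i theta d ->
  is_partial (fun th => c * F th) i theta (c * d).
Proof.
move=> Fd; have := is_partial_mul (is_partial_cst c i theta) Fd.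
by rewrite mulr0 addr0.
Qed.

(** The mixed partial derivative of [weight] of multi-index [k]: [k j] counts the differentiations
    in direction [j]. *)
Definition dweight theta k (t : 'I_M) : R :=
  \prod_(j < m) phase (k j) (bit t j) (theta j).

Definition incr k i : 'I_m -> nat := fun j => ((j == i) + k j)%N.

Lemma weightE theta t : weight theta t = dweight theta (fun=> 0%N) t.
Proof. by apply: eq_bigr => j _; rewrite /phase mul0r addr0. Qed.

Lemma is_partial_dweight k t i theta :
  is_partial (fun th => dweight th k t) i theta (dweight theta (incr k i) t).
Proof.
rewrite /is_partial /dweight.
rewrite (bigD1 i)//= /incr eqxx add1n mulrC.
under eq_bigr => j /negbTE ji do rewrite ji add0n.
set c := \prod_(j < m | _) _.
rewrite (_ : (fun y => _) = c \*: phase (k i) (bit t i)); last first.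
  apply/funext => y /=; rewrite (bigD1 i)//= {1}/upd eqxx mulrC; congr (_ * _).
  by apply: eq_bigr => j /negbTE ji; rewrite /upd ji.
exact: is_deriveZ (is_derive_phase _ _ _).
Qed.

Definition dmodel theta k (t : 'I_M) : R :=
  \sum_(s < M) feature xs (xs t) s * dweight theta k s.

Definition resid theta (t : 'I_M) : R := dmodel theta (fun=> 0%N) t - r t.

(** The vector [g = F^T e]; likewise [resid] is [e], and [dmodel] is [F] applied to a derivative of
    [w]. *)
Definition resid_feature theta (s : 'I_M) : R :=
  \sum_(t < M) resid theta t * feature xs (xs t) s.

Lemma is_partial_dmodel k t i theta :
  is_partial (fun th => dmodel th k t) i theta (dmodel theta (incr k i) t).
Proof.
apply: is_partial_sum => s; apply: is_partial_scale.
exact: is_partial_dweight.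
Qed.

Lemma is_partial_resid t i theta :
  is_partial (fun th => resid th t) i theta (dmodel theta (incr (fun=> 0%N) i) t).
Proof.
rewrite -[dmodel theta _ t]addr0.
exact: is_partial_add (is_partial_dmodel _ _ _ _) (is_partial_cst _ _ _).
Qed.

Lemma partial_loss i : partial (loss xs r) i = fun theta =>
  M%:R^-1 * \sum_(t < M) resid theta t * dmodel theta (incr (fun=> 0%N) i) t.
Proof.
apply/funext => theta.
rewrite (_ : loss xs r = fun th =>
    (2 * M%:R)^-1 * \sum_(t < M) resid th t * resid th t); last first.
  apply/funext => th; rewrite /loss; congr (_ * _); apply: eq_bigr => t _.
  rewrite expr2 /resid /dmodel.
  by under eq_bigr => s _ do rewrite weightE.
apply: is_partial_val.
have := is_partial_scale (2 * M%:R)^-1 (is_partial_sum (fun t =>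
  is_partial_mul (is_partial_resid t i theta) (is_partial_resid t i theta))).
congr (is_partial _ _ _ _).
(* The product rule gives two equal terms, whose factor 2 cancels the one in [(2 * M%:R)^-1]. *)
under eq_bigr => t _ do rewrite -mulr2n -mulr_natr.
rewrite -big_distrl /= invfM [_^-1 * _]mulrC -mulrA [X in _ * (_ * X)]mulrC.
by rewrite mulKf ?pnatr_eq0.
Qed.

(** Exchange of the sums over [t] and [s]. With [resid_feature] stored, the right side is a single
    sum of [M] products for each [k]. *)
Lemma sum_resid_dmodel theta k :
  \sum_(t < M) resid theta t * dmodel theta k t =
  \sum_(s < M) resid_feature theta s * dweight theta k s.
Proof.
rewrite /dmodel /resid_feature.
under eq_bigr do rewrite big_distrr.
rewrite exchange_big; apply: eq_bigr => s _; rewrite big_distrl /=.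
by apply: eq_bigr => t _; rewrite mulrA.
Qed.

Lemma gradE theta i : grad xs r theta i 0 =
  M%:R^-1 * \sum_(s < M)
    resid_feature theta s * dweight theta (incr (fun=> 0%N) i) s.
Proof. by rewrite mxE partial_loss sum_resid_dmodel. Qed.

(** The product rule is applied to [partial_loss], before the exchange of sums; the exchange then
    serves the second-order term. *)
Lemma hessianE theta i j : hessian xs r theta i j =
  M%:R^-1 * (\sum_(t < M) dmodel theta (incr (fun=> 0%N) i) t *
                          dmodel theta (incr (fun=> 0%N) j) t +
    \sum_(s < M)
      resid_feature theta s * dweight theta (incr (incr (fun=> 0%N) i) j) s).
Proof.
rewrite mxE partial_loss; apply: is_partial_val.
have := is_partial_scale M%:R^-1 (is_partial_sum (fun t =>
  is_partial_mul (is_partial_resid t j theta)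
    (is_partial_dmodel (incr (fun=> 0%N) i) t j theta))).
by rewrite big_split /= sum_resid_dmodel addrC.
Qed.

End Derivatives.

(** * Automation for costs of expressions *)

Ltac known := solve
  [ reflexivity | assumption | match goal with H : _ |- _ => by apply: H end
  | by right; first [ reflexivity | eexists; reflexivity
      | do 2 eexists; reflexivity | eexists; [exact: I | reflexivity] ]
  | left; known ].

(** Stored functions are tried first, so that they cost nothing; only then is the expression
    decomposed. *)
Ltac computes_step := first
  [ by apply: computes_mem; known
  | eapply computes_inv_nat | eapply computes_nat
  | eapply computes_sub | eapply computes_add | eapply computes_div
  | eapply computes_mul | eapply computes_opp | eapply computes_sqr
  | eapply computes_expR | eapply computes_sqrt
  | eapply computes_sum; intro | eapply computes_max; intro ].

Ltac computes_expr := eapply computes_leq; [repeat computes_step | ].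

(** * Cost of Huang's method *)

Section HuangCost.
Local Open Scope classical_set_scope.
Variables (R : realType) (E : Type) (m : nat).
Variables (H : E -> 'M[R]_m) (g : E -> 'cV[R]_m).
Implicit Types (A : set (E -> R)) (st : E -> 'cV[R]_m * 'M[R]_m).

Definition entries st : set (E -> R) :=
  (range (fun i e => (st e).1 i 0)) `|`
  [set f | exists i j, f = (fun e => (st e).2 i j)].

Lemma computes_huang_step A st k :
  (forall i j, A (fun e => H e i j)) -> (forall i, A (fun e => g e i 0)) ->
  entries st `<=` A ->
  computes A (5 * m ^ 2 + 7 * m + 4)
    (entries (fun e => huang_step (H e) (g e) (st e) k)).
Proof.
move=> HA gA stA.
have xA i : A (fun e => (st e).1 i 0) by apply: stA; left; exists i.
have PA i j : A (fun e => (st e).2 i j) by apply: stA; right; exists i, j.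
pose v i e := \sum_j (st e).2 i j * H e k j.
pose d e := \sum_j H e k j * v j e.
pose w e := (g e k 0 - \sum_j H e k j * (st e).1 j 0) / d e.
have step e : huang_step (H e) (g e) (st e) k =
    (\col_i ((st e).1 i 0 + v i e * w e),
     \matrix_(i, j) ((st e).2 i j - v i e * v j e / d e)).
  rewrite /w /d /v /huang_step; case: (st e) => x P /=.
  under [\sum_j H e k j * (\col_i _) j 0]eq_bigr do rewrite mxE.
  by congr (_, _); apply/matrixP => i j; rewrite !mxE.
(* The summands are the costs of [v], [d], [w], the new solution and the new projection, in this
   order. *)
apply: (@computes_leq _ _ _ (m * (m * 2).+1 + ((m * 2).+1 +
   ((m * 2).+3 + (m * 2 + m * m * 3))))); last by nia.
apply: (@computes_cut _ _ _ _ (range v)).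
  apply: computes_range_ord => i; rewrite /v.
  by computes_expr.
apply: (@computes_cut _ _ _ _ [set d]).
  by rewrite /d; computes_expr.
apply: (@computes_cut _ _ _ _ [set w]).
  by rewrite /w; computes_expr; lia.
apply: computesU.
  apply: computes_range_ord => i.
  apply: (@computes_eq _ _ _ _ (fun e => (st e).1 i 0 + v i e * w e)) => [e|].
    by rewrite step mxE.
  by computes_expr.
apply: computes_range2_ord => i j.
apply: (@computes_eq _ _ _ _ (fun e => (st e).2 i j - v i e * v j e / d e)) => [e|].
  by rewrite step mxE.
by computes_expr.
Qed.

Lemma computes_huang A :
  (forall i j, A (fun e => H e i j)) -> (forall i, A (fun e => g e i 0)) ->
  computes A (m + m ^ 2 + m * (5 * m ^ 2 + 7 * m + 4))
    (entries (fun e => huang (H e) (g e) (enum 'I_m))).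
Proof.
move=> HA gA.
(* The set [A'] is general because each step adds the entries of a new state to the available
   functions. *)
have loop (s : seq 'I_m) A' st : A `<=` A' -> entries st `<=` A' ->
    computes A' (size s * (5 * m ^ 2 + 7 * m + 4))
      (entries (fun e => foldl (huang_step (H e) (g e)) (st e) s)).
  elim: s A' st => [|k s IH] A' st AA' stA'; first exact: computes_subset.
  rewrite /= mulSn.
  apply: computes_cut (computes_huang_step (st := st) k _ _ _) _ => //.
  - by move=> i j; apply: AA'.
  - by move=> i; apply: AA'.
  - by apply: IH; [move=> f /AA'; left|move=> f; right].
apply: (@computes_cut _ _ _ _ (entries (fun=> (0, 1%:M)))).
  apply: computesU.
    rewrite -[X in computes _ X]muln1; apply: computes_range_ord => i.
    by apply: computes_eq (@computes_nat _ _ _ 0) => e; rewrite mxE.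
  rewrite -[(m ^ 2)%N]muln1 -mulnn.
  apply: computes_range2_ord => i j.
  by apply: computes_eq (@computes_nat _ _ _ (i == j)) => e; rewrite mxE.
rewrite -[X in (X * (_ + _))%N](size_enum_ord m).
by apply: loop => [f|f]; [left|right].
Qed.

End HuangCost.

(** * Costs of one gradient step and of one Newton step *)

Section StepCost.
Local Open Scope classical_set_scope.
Variables (R : realType) (E : Type) (n m : nat).
Local Notation M := (2 ^ m)%N.
Variables (xs : E -> 'I_M -> 'I_n -> R) (r : E -> 'I_M -> R).
Variables (th : E -> 'I_m -> R).
Implicit Types (A B : set (E -> R)).

(** The distances, the only part that depends on [n], are stored once and serve both [sigma] and the
    features. *)
Lemma computes_feature A : (forall t i, A (fun e => xs e t i)) ->
  computes A (M * M * (n * 4).+2 + ((M * (M * 1).+2).+1 + 5 + M * M * 8))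
    [set f | exists t s, f = fun e => feature (xs e) (xs e t) s].
Proof.
move=> xA.
pose dist a b e := eucl_norm (fun i => xs e a i - xs e b i).
apply: (@computes_cut _ _ _ _ [set f | exists a b, f = dist a b]).
  apply: computes_range2_ord => a b.
  by rewrite /dist /eucl_norm; computes_expr; lia.
apply: (@computes_cut _ _ _ _ [set fun e => sigma (xs e)]).
  rewrite /sigma -/(dist _ _ _).
  by computes_expr; lia.
apply: computes_range2_ord => t s.
rewrite /feature -/(dist _ _ _).
by computes_expr; lia.
Qed.

Lemma computes_phase A j (p b : nat) : A (fun e => th e j) ->
  (p <= 2)%N -> (b <= 1)%N ->
  computes A 3 [set fun e => phase p b (th e j)].
Proof.
move=> thA; have leq3 c B : computes A c B -> (c <= 3)%N -> computes A 3 B.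
  exact: computes_leq.
have sinA := computes_sin (computes_mem thA).
have cosA := computes_cos (computes_mem thA).
case: p => [|[|[|//]]] _; case: b => [|[|//]] _.
- by apply: leq3 (computes_eq _ cosA) _ => // e; rewrite phase00.
- by apply: leq3 (computes_eq _ sinA) _ => // e; rewrite phase01.
- by apply: computes_eq (computes_opp sinA) => // e; rewrite phase10.
- by apply: leq3 (computes_eq _ cosA) _ => // e; rewrite phase11.
- by apply: computes_eq (computes_opp cosA) => // e; rewrite phaseSS phase00.
- by apply: computes_eq (computes_opp sinA) => // e; rewrite phaseSS phase01.
Qed.

Lemma bit_le1 t j : (bit t j <= 1)%N.
Proof. by rewrite /bit; case: odd. Qed.

Lemma computes_dweight A (k : 'I_m -> nat) (s : 'I_M) :
  (forall j, A (fun e => th e j)) -> (forall j, k j <= 2)%N ->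
  computes A (m * 4).+1 [set fun e => dweight (th e) k s].
Proof.
move=> thA k2; rewrite /dweight; apply: computes_prod => j.
exact: computes_phase (bit_le1 _ _).
Qed.


Local Notation features :=
  [set f | exists t s, f = fun e => feature (xs e) (xs e t) s].
Local Notation resid_features :=
  (range (fun s e => resid_feature (xs e) (r e) (th e) s)).
Local Notation k0 := (fun=> 0%N).

Lemma incr_leq1 (i j : 'I_m) : (incr k0 i j <= 1)%N.
Proof. by rewrite /incr; case: eqP. Qed.

Lemma incr_leq2 (i j l : 'I_m) : (incr (incr k0 i) j l <= 2)%N.
Proof. by rewrite /incr; do 2 case: eqP. Qed.

(** Stored in turn are the features, the weights and the residuals, so each entry of [resid] or
    [resid_feature] costs O(M). The features are kept for the products [dmodel] of Newton's
    method. *)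
Lemma computes_resid_feature A :
  (forall t i, A (fun e => xs e t i)) -> (forall t, A (fun e => r e t)) ->
  (forall j, A (fun e => th e j)) ->
  computes A (M * M * (n * 4).+2 + ((M * (M * 1).+2).+1 + 5 + M * M * 8) +
      (M * (m * 4).+1 + (M * (M * 2).+2 + M * (M * 2).+1)))
    (features `|` resid_features).
Proof.
move=> xA rA thA.
apply: computes_cut (computes_feature xA) _.
apply: (@computes_cut _ _ _ _ (range (fun s e => dweight (th e) k0 s))).
  by apply: computes_range_ord => s; apply: computes_dweight => // j; left.
apply: (@computes_cut _ _ _ _ (range (fun t e => resid (xs e) (r e) (th e) t))).
  apply: computes_range_ord => t; rewrite /resid /dmodel.
  by computes_expr; lia.
rewrite -[(M * (M * 2).+1)%N]add0n; apply: computesU.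
  by apply: computes_subset => f Ff; left; left; right.
apply: computes_range_ord => s; rewrite /resid_feature.
by computes_expr; lia.
Qed.

(** The derivatives of the weights are recomputed for each [i], at cost O(m M); all coordinates
    together take O(m^2 M). *)
Lemma computes_grad A (i : 'I_m) :
  (forall s, A (fun e => resid_feature (xs e) (r e) (th e) s)) ->
  (forall j, A (fun e => th e j)) ->
  computes A (M * (m * 4 + 3) + 3) [set fun e => grad (xs e) (r e) (th e) i 0].
Proof.
move=> rfA thA; apply: computes_eq => [e|]; first by rewrite gradE.
eapply computes_leq.
  apply: computes_mul; first exact: computes_inv_nat.
  apply: computes_sum => s; apply: computes_mul; first exact: computes_mem.
  by apply: computes_dweight => // j; apply: leqW; apply: incr_leq1.
by lia.
Qed.

Lemma computes_gd_step A (eta : E -> R) :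
  (forall t i, A (fun e => xs e t i)) -> (forall t, A (fun e => r e t)) ->
  (forall j, A (fun e => th e j)) -> A eta ->
  computes A (M * M * (n * 4).+2 + ((M * (M * 1).+2).+1 + 5 + M * M * 8) +
      (M * (m * 4).+1 + (M * (M * 2).+2 + M * (M * 2).+1)) +
      m * (M * (m * 4 + 3) + 5))
    (range (fun j e => gd_step (xs e) (r e) (eta e) (th e) j)).
Proof.
move=> xA rA thA etaA.
apply: computes_cut (computes_resid_feature xA rA thA) _.
apply: computes_range_ord => j; rewrite /gd_step.
eapply computes_leq.
  apply: computes_sub; first by apply: computes_mem; known.
  apply: computes_mul; first by apply: computes_mem; known.
  by apply: computes_grad => [s|l]; [right; right; exists s|left].
by lia.
Qed.

(** With the [dmodel] stored, an entry costs O(m M), and the whole matrix O(m^3 M), which is within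
    O(m^2 M^2). *)
Lemma computes_hessian A (i j : 'I_m) :
  (forall s, A (fun e => resid_feature (xs e) (r e) (th e) s)) ->
  (forall j, A (fun e => th e j)) ->
  (forall i t, A (fun e => dmodel (xs e) (th e) (incr k0 i) t)) ->
  computes A (M * (m * 4 + 5) + 5)
    [set fun e => hessian (xs e) (r e) (th e) i j].
Proof.
move=> rfA thA dmA; apply: computes_eq => [e|]; first by rewrite hessianE.
eapply computes_leq.
  apply: computes_mul; first exact: computes_inv_nat.
  apply: computes_add; apply: computes_sum => s; apply: computes_mul.
  - exact: computes_mem.
  - exact: computes_mem.
  - exact: computes_mem.
  - by apply: computes_dweight => // l; apply: incr_leq2.
by lia.
Qed.

(** The stages are [resid_feature], first derivatives of the weights, their products with the
    features, gradient, Hessian, Huang's method and the final subtraction. The output is stated with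
    [huang], which makes sense even for a singular Hessian. *)
Lemma computes_newton_step A :
  (forall t i, A (fun e => xs e t i)) -> (forall t, A (fun e => r e t)) ->
  (forall j, A (fun e => th e j)) ->
  computes A (M * M * (n * 4).+2 + ((M * (M * 1).+2).+1 + 5 + M * M * 8) +
      (M * (m * 4).+1 + (M * (M * 2).+2 + M * (M * 2).+1)) +
      (m * M * (m * 4).+1 + (m * M * (M * 2).+1 +
      (m * (M * (m * 4 + 3) + 3) + (m * m * (M * (m * 4 + 5) + 5) +
      (m + m ^ 2 + m * (5 * m ^ 2 + 7 * m + 4) + m * 1))))))
    (range (fun j e => th e j -
      (huang (hessian (xs e) (r e) (th e)) (grad (xs e) (r e) (th e))
         (enum 'I_m)).1 j 0)).
Proof.
move=> xA rA thA.
apply: computes_cut (computes_resid_feature xA rA thA) _.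
apply: (@computes_cut _ _ _ _
    [set f | exists i s, f = fun e => dweight (th e) (incr k0 i) s]).
  apply: computes_range2_ord => i s; apply: computes_dweight => [j|j]; first by left.
  by apply: leqW; apply: incr_leq1.
apply: (@computes_cut _ _ _ _
    [set f | exists i t, f = fun e => dmodel (xs e) (th e) (incr k0 i) t]).
  apply: computes_range2_ord => i t; rewrite /dmodel.
  apply: (@computes_leq _ _ _ (M * (0 + 0).+2).+1); last by lia.
  apply: computes_sum => s; apply: computes_mul; apply: computes_mem.
    by left; right; left; exists t, s.
  by right; exists i, s.
apply: (@computes_cut _ _ _ _
    (range (fun i e => grad (xs e) (r e) (th e) i 0))).
  apply: computes_range_ord => i; apply: computes_grad => [s|j].
    by left; left; right; right; exists s.
  by do 3 left.
apply: (@computes_cut _ _ _ _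
    [set f | exists i j, f = fun e => hessian (xs e) (r e) (th e) i j]).
  apply: computes_range2_ord => i j; apply: computes_hessian => [s|l|l t].
  - by do 3 left; right; right; exists s.
  - by do 4 left.
  - by left; right; exists l, t.
apply: computes_cut (computes_huang (H := fun e => hessian (xs e) (r e) (th e))
  (g := fun e => grad (xs e) (r e) (th e)) _ _) _ => [i j|i|].
- by right; exists i, j.
- by left; right; exists i.
apply: computes_range_ord => j; apply: (@computes_sub _ _ _ 0 0); apply: computes_mem.
  by do 6 left.
by right; left; exists j.
Qed.

End StepCost.

(** * Polynomial bounds on the total costs *)

Lemma gd_cost_bound (n m M : nat) : (0 < n)%N -> (0 < m)%N -> (m <= M)%N ->
  (m * m <= 2 * M)%N ->
  (M * M * (n * 4).+2 + ((M * (M * 1).+2).+1 + 5 + M * M * 8) +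
      (M * (m * 4).+1 + (M * (M * 2).+2 + M * (M * 2).+1)) +
      m * (M * (m * 4 + 3) + 5) <= 100 * n * M ^ 2)%N.
Proof.
move=> n0 m0 mM mmM; rewrite -mulnn.
have M1 : (M <= M * M)%N by rewrite leq_pmulr//; lia.
have M2 : (M * M <= n * (M * M))%N by rewrite leq_pmull.
have M3 : (m * M <= M * M)%N by rewrite leq_mul.
(* This absorbs the derivatives of the weights in the gradient. *)
have M4 : (m * m * M <= 2 * M * M)%N by rewrite leq_mul.
by nia.
Qed.

Lemma newton_cost_bound (n m M : nat) : (0 < n)%N -> (0 < m)%N -> (m <= M)%N ->
  (M * M * (n * 4).+2 + ((M * (M * 1).+2).+1 + 5 + M * M * 8) +
      (M * (m * 4).+1 + (M * (M * 2).+2 + M * (M * 2).+1)) +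
      (m * M * (m * 4).+1 + (m * M * (M * 2).+1 +
      (m * (M * (m * 4 + 3) + 3) + (m * m * (M * (m * 4 + 5) + 5) +
      (m + m ^ 2 + m * (5 * m ^ 2 + 7 * m + 4) + m * 1)))))
   <= 100 * M ^ 2 * (n + m ^ 2))%N.
Proof.
move=> n0 m0 mM; rewrite -!mulnn.
have M1 : (M <= M * M)%N by rewrite leq_pmulr//; lia.
have M2 : (M * M <= n * (M * M))%N by rewrite leq_pmull.
have m1 : (m <= m * m)%N by rewrite leq_pmulr.
have M3 : (m * M <= m * m * (M * M))%N by rewrite leq_mul.
have M4 : (m * m * M <= m * m * (M * M))%N by rewrite leq_mul.
(* This absorbs the second derivatives of the weights in the Hessian. *)
have M5 : (m * m * (m * M) <= m * m * (M * M))%N by rewrite !leq_mul.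
have M6 : (m * (M * M) <= m * m * (M * M))%N by rewrite leq_mul.
have M7 : (m * m * m <= m * m * M)%N by rewrite leq_mul.
by nia.
Qed.

(** The factor 2 is there for [m = 3], where [m * m] exceeds [2 ^ m]. *)
Lemma sqr_leq_exp2 m : (m * m <= 2 * 2 ^ m)%N.
Proof.
have [|m3] := leqP m 3; first by case: m => [|[|[|[|]]]].
elim: m m3 => // m IH; rewrite ltnS leq_eqVlt => /orP[/eqP <- //|m3].
have := IH m3; rewrite expnS; move: (2 ^ m)%N => N; nia.
Qed.

(** * The encoded input as a list of coordinate functions *)

Section InputRegisters.
Variables (R : realType) (E : Type) (n m : nat).
Local Notation M := (2 ^ m)%N.
Variables (xs : E -> 'I_M -> 'I_n -> R) (r : E -> 'I_M -> R).
Variables (th : E -> 'I_m -> R) (extra : seq (E -> R)).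

Definition input_regs : seq (E -> R) :=
  flatten [seq [seq (fun e => xs e t i) | i <- enum 'I_n] | t <- enum 'I_M]
  ++ [seq (fun e => r e t) | t <- enum 'I_M]
  ++ [seq (fun e => th e j) | j <- enum 'I_m] ++ extra.

Lemma map_input_regs e : [seq f e | f <- input_regs] =
  encode (xs e) (r e) (th e) [seq f e | f <- extra].
Proof.
rewrite /encode /input_regs !map_cat map_flatten -!map_comp.
by congr (flatten _ ++ _); apply: eq_map => t /=; rewrite -map_comp.
Qed.

Lemma mem_input_xs t i : (fun e => xs e t i) \in input_regs.
Proof.
rewrite mem_cat; apply/orP; left; apply/flattenP.
exists [seq (fun e => xs e t i) | i <- enum 'I_n].
  by apply/mapP; exists t; rewrite ?mem_enum.
by apply/mapP; exists i; rewrite ?mem_enum.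
Qed.

Lemma mem_input_r t : (fun e => r e t) \in input_regs.
Proof.
rewrite !mem_cat; apply/orP; right; apply/orP; left.
by apply/mapP; exists t; rewrite ?mem_enum.
Qed.

Lemma mem_input_theta j : (fun e => th e j) \in input_regs.
Proof.
rewrite !mem_cat; apply/orP; right; apply/orP; right; apply/orP; left.
by apply/mapP; exists j; rewrite ?mem_enum.
Qed.

Lemma mem_input_extra f : f \in extra -> f \in input_regs.
Proof. by move=> fx; rewrite !mem_cat fx !orbT. Qed.

End InputRegisters.

(** * The two programs and their costs *)

Theorem theorem1 (R : realType) :
  (* gradient descent: cost O(n M^2) *)
  (exists C : nat, forall n m : nat, (0 < n)%N -> (0 < m)%N ->
     exists P : slp, (slp_cost P <= C * n * (2 ^ m) ^ 2)%N /\
       forall (xs : 'I_(2 ^ m) -> 'I_n -> R) (r : 'I_(2 ^ m) -> R)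
              (theta : 'I_m -> R) (eta : R),
         (forall t, r t = 1 \/ r t = -1) ->
         slp_eval P (encode xs r theta [:: eta])
           = vec_out (gd_step xs r eta theta))
  /\
  (* Newton's method: cost O(M^2 (n + log^2 M)), log_2 M = m *)
  (exists C : nat, forall n m : nat, (0 < n)%N -> (0 < m)%N ->
     exists P : slp, (slp_cost P <= C * (2 ^ m) ^ 2 * (n + m ^ 2))%N /\
       forall (xs : 'I_(2 ^ m) -> 'I_n -> R) (r : 'I_(2 ^ m) -> R)
              (theta : 'I_m -> R),
         (forall t, r t = 1 \/ r t = -1) ->
         hessian xs r theta \in unitmx ->
         slp_eval P (encode xs r theta [::])
           = vec_out (newton_step xs r theta)).
Proof.
split; exists 100%N => n m n0 m0.
  (* [E] gathers all the data, so the program obtained depends on [n] and [m] alone. *)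
  pose E := (('I_(2 ^ m) -> 'I_n -> R) * ('I_(2 ^ m) -> R) * ('I_m -> R) * R)%type.
  pose xs (e : E) := e.1.1.1; pose r (e : E) := e.1.1.2.
  pose th (e : E) := e.1.2; pose eta (e : E) := e.2.
  have [P cP PE] := computes_slp (A := [set` input_regs xs r th [:: eta]]%classic)
    (map_input_regs xs r th [:: eta]) (fun f fP => fP)
    (computes_gd_step (eta := eta) (@mem_input_xs _ _ _ _ xs r th _)
       (@mem_input_r _ _ _ _ xs r th _) (@mem_input_theta _ _ _ _ xs r th _)
       (@mem_input_extra _ _ _ _ xs r th _ _ (mem_head _ _))).
  exists P; split.
    apply: leq_trans cP _; apply: gd_cost_bound => //.
      exact/ltnW/ltn_expl.
    exact: sqr_leq_exp2.
  by move=> x q theta h _; apply: (PE (x, q, theta, h)).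
pose E := (('I_(2 ^ m) -> 'I_n -> R) * ('I_(2 ^ m) -> R) * ('I_m -> R))%type.
pose xs (e : E) := e.1.1; pose r (e : E) := e.1.2; pose th (e : E) := e.2.
have [P cP PE] := computes_slp (A := [set` input_regs xs r th [::]]%classic)
  (map_input_regs xs r th [::]) (fun f fP => fP)
  (computes_newton_step (@mem_input_xs _ _ _ _ xs r th _)
     (@mem_input_r _ _ _ _ xs r th _) (@mem_input_theta _ _ _ _ xs r th _)).
exists P; split.
  apply: leq_trans cP _; apply: newton_cost_bound => //.
  exact/ltnW/ltn_expl.
(* Invertibility of the Hessian enters here: it identifies the output of Huang's method with the
   Newton direction. *)
move=> x q theta _ Hu; rewrite (PE (x, q, theta)).
by apply: eq_map => j; rewrite huangP.
Qed.
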